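(* Consider a sequence of experiments indexed by the sample size $n$ in which treatment is assigned by a Bernoulli design for each $n$. Suppose the regularity conditions (Assumption R in the context) hold with $q\ge 4$, that $d_{\mathrm{avg}}=o(n)$, and that $SD_{\sigma^2}=o\big(d_{\mathrm{rms}}^{-1}d_{\mathrm{avg}}\big)$, where $$SD_{\sigma^2}=\sqrt{\frac1n\sum_{i=1}^n\Big[\sigma_i^2-\frac1n\sum_{j=1}^n\sigma_j^2\Big]^2},\qquad \sigma_i^2=\mathrm{Var}\Big(\frac{Z_iY_i}{p_i}-\frac{(1-Z_i)Y_i}{1-p_i}\Big),\qquad d_{\mathrm{rms}}=\sqrt{\frac1n\sum_{i=1}^n d_i^2}.$$ Then the variance estimator $\widehat{\mathrm{Var}}_{AVG}(\hat\tau_{HT})=d_{\mathrm{avg}}\,\widehat{\mathrm{Var}}_{BER}(\hat\tau_{HT})$ is asymptotically conservative.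
   Context: Setting. For each sample size $n$ there are units $U=\{1,\dots,n\}$ and arbitrary potential outcome functions $y_i:\{0,1\}^n\to\mathbb R$, $i\in U$. For $\mathbf z\in\{0,1\}^n$, $\mathbf z_{-i}$ is $\mathbf z$ with its $i$th entry deleted, and $y_i(\mathbf z)$ is also written $y_i(z_i;\mathbf z_{-i})$. An experimental design is the probability distribution of a random vector $\mathbf Z=(Z_1,\dots,Z_n)\in\{0,1\}^n$; it is the only source of randomness. Write $Y_i=y_i(\mathbf Z)$ and $p_i=\Pr(Z_i=1)$. All objects depend on $n$, with no relation assumed between different $n$; asymptotics are as $n\to\infty$. Assumption R (regularity conditions). There are constants $k<\infty$, $q\ge 2$, $s\ge 1$ such that for all $n$ and all $i\in U$: $k^{-1}\le \Pr(Z_i=1)\le 1-k^{-1}$; $E[|Y_i|^q]\le k^q$; and $E[|y_i(z;\mathbf Z_{-i})|^s]\le k^s$ for $z\in\{0,1\}$. Bernoulli design: $\Pr(\mathbf Z=\mathbf z)=\prod_{i=1}^n p_i^{z_i}(1-p_i)^{1-z_i}$. Interference. $I_{ij}=1$ if $i=j$ or if $y_j(\mathbf z)\ne y_j(\mathbf z')$ for some $\mathbf z,\mathbf z'\in\{0,1\}^n$ with $\mathbf z_{-i}=\mathbf z'_{-i}$; otherwise $I_{ij}=0$. $d_{ij}=1$ if $I_{\ell i}I_{\ell j}=1$ for some $\ell\in U$, else $d_{ij}=0$; $d_i=\sum_{j=1}^n d_{ij}$; $d_{\mathrm{avg}}=n^{-1}\sum_{i=1}^n d_i$. Estimators: $\hat\tau_{HT}=\frac1n\sum_i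 \frac{Z_iY_i}{p_i}-\frac1n\sum_i\frac{(1-Z_i)Y_i}{1-p_i}$ and $\widehat{\mathrm{Var}}_{BER}(\hat\tau_{HT})=\frac1{n^2}\sum_i\frac{Z_iY_i^2}{p_i^2}+\frac1{n^2}\sum_i\frac{(1-Z_i)Y_i^2}{(1-p_i)^2}$. A variance estimator $\hat V$ is asymptotically conservative (with respect to the variance of $\hat\tau_{HT}$) if $$\lim_{\varepsilon\to0^+}\lim_{n\to\infty}\Pr\Big(n\,d_{\mathrm{avg}}^{-1}\big[\hat V-\mathrm{Var}(\hat\tau_{HT})\big]\le-\varepsilon\Big)=0.$$ *)

(* Defs.v *)
From HB Require Import structures.
From mathcomp Require Import all_boot all_order all_algebra.
From mathcomp Require Import all_classical all_reals all_analysis.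

Set Implicit Arguments.
Unset Strict Implicit.
Unset Printing Implicit Defensive.

Import Order.TTheory GRing.Theory Num.Theory.
Import numFieldNormedType.Exports.

Local Open Scope classical_set_scope.
Local Open Scope ring_scope.

Definition assignment (n : nat) := {ffun 'I_n -> bool}.

(* The law of Z; as the design is the only source of randomness, {0,1}^n with
   this mass function serves as the probability space, with Z the identity. *)
Record design (R : realType) (n : nat) := Design {
  pmf :> assignment n -> R;
  pmf_ge0 : forall z, 0 <= pmf z;
  pmf_sum1 : \sum_z pmf z = 1
}.

Definition outcomes (R : realType) (n : nat) := 'I_n -> assignment n -> R.

Section Probability.
Context {R : realType} {n : nat}.
Variable D : design R n.

Definition Pr (A : pred (assignment n)) : R := \sum_(z | A z) D z.

Definition Ex (f : assignment n -> R) : R := \sum_z D z * f z.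

Definition Var (f : assignment n -> R) : R :=
  Ex (fun z => (f z - Ex f) ^+ 2).

Definition prop_treated (i : 'I_n) : R := Pr (fun z => z i).

Definition bernoulli_design : Prop :=
  forall z, D z = \prod_(i < n)
    (prop_treated i ^+ z i * (1 - prop_treated i) ^+ (1 - z i)%N).

End Probability.

(* (b; z_{-i}): the assignment z with its i-th entry replaced by b. *)
Definition set_treatment (n : nat) (i : 'I_n) (b : bool) (z : assignment n) :
  assignment n := [ffun j => if j == i then b else z j].

(* z_{-i} = z'_{-i} *)
Definition eq_except (n : nat) (i : 'I_n) (z z' : assignment n) : bool :=
  [forall j, (j != i) ==> (z j == z' j)].

Section Interference.
Context {R : realType} {n : nat}.
Variable y : outcomes R n.

(* I_ij: the treatment of i interferes with the outcome of j. *)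
Definition interferes (i j : 'I_n) : bool :=
  (i == j) ||
  [exists z, exists z', eq_except i z z' && (y j z != y j z')].

Definition dependent (i j : 'I_n) : bool :=
  [exists l, interferes l i && interferes l j].

Definition degree (i : 'I_n) : nat := (\sum_(j < n) dependent i j)%N.

Definition d_avg : R := n%:R^-1 * \sum_(i < n) (degree i)%:R.

Definition d_rms : R :=
  Num.sqrt (n%:R^-1 * \sum_(i < n) (degree i)%:R ^+ 2).

End Interference.

Section Estimators.
Context {R : realType} {n : nat}.
Variables (y : outcomes R n) (D : design R n).

Local Notation p := (prop_treated D).

Definition tau_HT (z : assignment n) : R :=
  n%:R^-1 * (\sum_(i < n) (z i)%:R * y i z / p i)
  - n%:R^-1 * (\sum_(i < n) (1 - (z i)%:R) * y i z / (1 - p i)).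

Definition var_BER (z : assignment n) : R :=
  (n%:R ^+ 2)^-1 * (\sum_(i < n) (z i)%:R * y i z ^+ 2 / p i ^+ 2)
  + (n%:R ^+ 2)^-1 *
      (\sum_(i < n) (1 - (z i)%:R) * y i z ^+ 2 / (1 - p i) ^+ 2).

Definition var_AVG (z : assignment n) : R := d_avg y * var_BER z.

Definition sigma2 (i : 'I_n) : R :=
  Var D (fun z => (z i)%:R * y i z / p i - (1 - (z i)%:R) * y i z / (1 - p i)).

Definition SD_sigma2 : R :=
  Num.sqrt (n%:R^-1 * \sum_(i < n)
    (sigma2 i - n%:R^-1 * \sum_(j < n) sigma2 j) ^+ 2).

End Estimators.

(* Sequences are indexed by all n : nat.  At n = 0 there are no units, and the
   value there is irrelevant to the asymptotics.
   [0 < k] makes k^-1 and the real powers k `^ q, k `^ s meaningful. *)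
Definition regularity (R : realType) (y : forall n, outcomes R n)
    (D : forall n, design R n) (k q s : R) : Prop :=
  [/\ 0 < k, 2 <= q, 1 <= s &
   forall (n : nat) (i : 'I_n),
     [/\ k^-1 <= prop_treated (D n) i <= 1 - k^-1,
         Ex (D n) (fun z => `|y n i z| `^ q) <= k `^ q &
         forall b : bool,
           Ex (D n) (fun z => `|y n i (set_treatment i b z)| `^ s) <= k `^ s]].

(* The iterated limit; since [limn] is total, the existence of each inner
   limit is asserted separately. *)
Definition asymptotically_conservative (R : realType)
    (y : forall n, outcomes R n) (D : forall n, design R n)
    (V : forall n, assignment n -> R) : Prop :=
  let prob (eps : R) (n : nat) : R :=
    Pr (D n) (fun z =>
      n%:R * (d_avg (y n))^-1 * (V n z - Var (D n) (tau_HT (y n) (D n)))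
        <= - eps) in
  (forall eps : R, 0 < eps -> cvgn (prob eps)) /\
  limn (prob eps) @[eps --> 0^'+] --> (0 : R).

(* Main.v *)
(** Let X_i be the i-th Horvitz-Thompson term, so that the estimator is the mean
    of the X_i and n * Var_BER = W, the mean of the X_i^2.  Under a Bernoulli
    design X_i and X_j are independent unless d_ij = 1, hence
    n^2 Var(tau_HT) <= sum_i d_i sigma_i^2; by Cauchy-Schwarz this is at most
    n d_avg times the mean of the sigma_i^2, up to the error n d_rms SD.
    That mean is at most E W.  So the rescaled difference is at least
    W - E W - d_rms SD / d_avg, whose last term vanishes, and Chebyshev applies
    to W because Var W = O(d_avg / n) by the same covariance bound and the
    fourth moments. *)

Require Import Defs.
From HB Require Import structures.
From mathcomp Require Import all_boot all_order all_algebra.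
From mathcomp Require Import all_classical all_reals all_analysis.
From mathcomp Require Import ring lra.

Set Implicit Arguments.
Unset Strict Implicit.
Unset Printing Implicit Defensive.

Import Order.TTheory GRing.Theory Num.Theory.
Import numFieldNormedType.Exports.

Local Open Scope classical_set_scope.
Local Open Scope ring_scope.

(** * Expectation, variance and a one-sided Chebyshev bound under a finite design *)

Section FiniteProbability.
Context {R : realType} {n : nat}.
Variable D : design R n.
Implicit Types f g : assignment n -> R.

Lemma eq_Ex f g : f =1 g -> Ex D f = Ex D g.
Proof. by move=> fg; apply: eq_bigr => z _; rewrite fg. Qed.

Lemma eq_Var f g : f =1 g -> Var D f = Var D g.
Proof. by move=> fg; apply: eq_Ex => z; rewrite fg (eq_Ex fg). Qed.

Lemma le_Ex f g : (forall z, f z <= g z) -> Ex D f <= Ex D g.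
Proof.
by move=> fg; apply: ler_sum => z _; rewrite ler_wpM2l // Defs.pmf_ge0.
Qed.

Lemma Ex_cst c : Ex D (fun=> c) = c.
Proof. by rewrite /Ex -mulr_suml Defs.pmf_sum1 mul1r. Qed.

Lemma ExD f g : Ex D (fun z => f z + g z) = Ex D f + Ex D g.
Proof. by rewrite /Ex -big_split; apply: eq_bigr => z _; rewrite mulrDr. Qed.

Lemma ExZ c f : Ex D (fun z => c * f z) = c * Ex D f.
Proof. by rewrite /Ex mulr_sumr; apply: eq_bigr => z _; rewrite mulrCA. Qed.

Lemma Ex_sum (I : finType) (F : I -> assignment n -> R) :
  Ex D (fun z => \sum_i F i z) = \sum_i Ex D (F i).
Proof.
by rewrite /Ex exchange_big; apply: eq_bigr => z _; rewrite mulr_sumr.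
Qed.

Lemma Ex_centered f : Ex D (fun z => f z - Ex D f) = 0.
Proof. by rewrite ExD Ex_cst subrr. Qed.

Lemma VarE f : Var D f = Ex D (fun z => f z ^+ 2) - Ex D f ^+ 2.
Proof.
rewrite /Var (eq_Ex (g := fun z =>
  f z ^+ 2 + (- 2 * Ex D f * f z + Ex D f ^+ 2))); last by move=> z; ring.
by rewrite !ExD ExZ Ex_cst; ring.
Qed.

Lemma Var_le_Ex_sqr f : Var D f <= Ex D (fun z => f z ^+ 2).
Proof. by rewrite VarE gerBl sqr_ge0. Qed.

Lemma VarZ c f : Var D (fun z => c * f z) = c ^+ 2 * Var D f.
Proof.
by rewrite /Var ExZ -[RHS]ExZ; apply: eq_Ex => z; rewrite -mulrBr exprMn.
Qed.

Lemma chebyshev_lower f a : 0 < a ->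
  Pr D (fun z => f z - Ex D f <= - a) <= Var D f / a ^+ 2.
Proof.
move=> a0; rewrite ler_pdivlMr ?exprn_gt0 // /Pr /Var /Ex mulr_suml big_mkcond.
apply: ler_sum => z _; case: ifPn => [h|_].
  rewrite ler_wpM2l ?Defs.pmf_ge0 //.
    have ah : a <= - (f z - Ex D f) by rewrite lerNr.
    by rewrite -[leRHS]sqrrN lerXn2r // nnegrE ltW // (lt_le_trans a0).
by rewrite mulr_ge0 ?Defs.pmf_ge0 ?sqr_ge0.
Qed.

Lemma le_Pr (A B : pred (assignment n)) :
  (forall z, A z -> B z) -> Pr D A <= Pr D B.
Proof.
move=> AB; rewrite /Pr big_mkcond [leRHS]big_mkcond; apply: ler_sum => z _.
by case: ifPn => [/AB ->//|_]; case: ifP => // _; exact: Defs.pmf_ge0.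
Qed.

Lemma Pr_ge0 A : 0 <= Pr D A.
Proof. by apply: sumr_ge0 => z _; exact: Defs.pmf_ge0. Qed.

End FiniteProbability.

(** * Functions of some of the coordinates, and independence under a Bernoulli design *)

Definition depends_on (n : nat) (T : Type) (S : pred 'I_n)
    (f : assignment n -> T) : Prop :=
  forall z z' : assignment n, (forall i, S i -> z i = z' i) -> f z = f z'.

Definition splice (n : nat) (S : pred 'I_n) (z z' : assignment n) :
  assignment n := [ffun i => if S i then z i else z' i].

(** Applied in both components, this makes the exchange of coordinates between two assignments an
    involution, hence a valid reindexing. *)
Lemma spliceK n (S : pred 'I_n) z z' :
  splice S (splice S z z') (splice S z' z) = z.
Proof. by apply/ffunP => i; rewrite !ffunE; case: (S i). Qed.

(* Exchanging the coordinates in S of two independent copies z, z' of Z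
   preserves their joint law, and turns f z * g z' into f * g evaluated at a
   single copy. *)
Lemma bernoulli_indep (R : realType) n (D : design R n) (S T : pred 'I_n) f g :
  bernoulli_design D -> (forall i, S i -> ~~ T i) ->
  depends_on S f -> depends_on T g ->
  Ex D (fun z => f z * g z) = Ex D f * Ex D g.
Proof.
move=> DB ST Sf Tg.
pose swap (u : assignment n * assignment n) :=
  (splice S u.1 u.2, splice S u.2 u.1).
have swapK : involutive swap by case=> z z'; rewrite /swap /= !spliceK.
rewrite {2 3}/Ex mulr_suml.
under eq_bigr do rewrite mulr_sumr.
rewrite pair_bigA (reindex_inj (inv_inj swapK)) /=.
(* A second copy of the assignment, of total mass one, is added on the left. *)
transitivity (\sum_(u : assignment n * assignment n)
    (D u.1 * (f u.1 * g u.1)) * D u.2).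
  rewrite -(pair_bigA _ (fun z z' => D z * (f z * g z) * D z')) /=.
  by apply: eq_bigr => z _; rewrite -mulr_sumr Defs.pmf_sum1 mulr1.
apply: eq_bigr => -[z z'] _ /=.
have -> : f (splice S z z') = f z.
  by apply: Sf => i Si; rewrite ffunE Si.
have -> : g (splice S z' z) = g z.
  apply: Tg => i Ti; rewrite ffunE; case: ifP => // /ST; by rewrite Ti.
(* The mass function is a product, so the exchange at most swaps the two factors at each
   coordinate. *)
have DD : D (splice S z z') * D (splice S z' z) = D z * D z'.
  rewrite !DB -!big_split /=; apply: eq_bigr => i _; rewrite !ffunE.
  by case: (S i) => //; rewrite mulrC.
by rewrite mulrACA DD; ring.
Qed.

(** [interferes] only tests changes of a single coordinate. Hence [z] is moved to [z'] one differing
    coordinate at a time, by induction on their number; no such move changes the outcome. *)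
Lemma depends_on_interferes (R : realType) n (y : outcomes R n) j :
  depends_on (fun i => interferes y i j) (y j).
Proof.
move=> z z'; have [m] := ubnP #|[pred i | z i != z' i]|.
elim: m z => // m IH z; rewrite ltnS => zm zz'.
have [i zi|e0] := pickP [pred i | z i != z' i]; last first.
  congr (y j _); apply/ffunP => i; apply/eqP/negPn.
  exact: (negbT (e0 i)).
have nI : ~~ interferes y i j by apply: contra zi => /zz' ->.
transitivity (y j (set_treatment i (z' i) z)).
  apply/eqP/negPn/negP => yj; move/negP: nI; apply.
  apply/orP; right; apply/existsP; exists z.
  apply/existsP; exists (set_treatment i (z' i) z); rewrite yj andbT.
  by apply/forallP => l; apply/implyP => /negPf li; rewrite ffunE li.
apply: IH => [|l /zz' zl]; last by rewrite ffunE; case: eqP => [->|].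
apply: leq_trans zm; apply: proper_card; apply/properP; split.
  apply/fintype.subsetP => l; rewrite !inE ffunE.
  by have [->|//] := eqVneq l i; rewrite eqxx.
by exists i; rewrite !inE // ffunE !eqxx.
Qed.

(** * Variance of sums along the dependency graph *)

Section DependencyGraph.
Context {R : realType} {n : nat}.
Variables (y : outcomes R n) (D : design R n).

Lemma dependentC i j : dependent y i j = dependent y j i.
Proof. by apply: eq_existsb => l; rewrite andbC. Qed.

(** Each unit is dependent on itself. This makes [d_avg] and [d_rms] positive, hence safe to divide
    by, once [n] is positive. *)
Lemma degree_gt0 i : (0 < degree y i)%N.
Proof.
rewrite /degree (bigD1 i) //= addn_gt0; apply/orP; left; rewrite lt0b.
by apply/existsP; exists i; rewrite /interferes eqxx.
Qed.

Lemma natr_degree i : (degree y i)%:R = \sum_j (dependent y i j)%:R :> R.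
Proof. by rewrite natr_sum. Qed.

Lemma d_avg_gt0 : (0 < n)%N -> 0 < d_avg y.
Proof.
move=> n0; rewrite /d_avg mulr_gt0 ?invr_gt0 ?ltr0n //.
rewrite (bigD1 (Ordinal n0)) //= ltr_wpDr ?ltr0n ?degree_gt0 //.
by apply: sumr_ge0 => i _; rewrite ler0n.
Qed.

Lemma d_rms_gt0 : (0 < n)%N -> 0 < d_rms y.
Proof.
move=> n0; rewrite /d_rms sqrtr_gt0 mulr_gt0 ?invr_gt0 ?ltr0n //.
rewrite (bigD1 (Ordinal n0)) //= ltr_wpDr ?exprn_gt0 ?ltr0n ?degree_gt0 //.
by apply: sumr_ge0 => i _; rewrite sqr_ge0.
Qed.

(* Only the pairs with d_ij = 1 have nonzero covariance, and
   2 ab <= a^2 + b^2 bounds it by the average of the two variances. *)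
Lemma Var_sum_le (f : 'I_n -> assignment n -> R) :
  bernoulli_design D ->
  (forall j, depends_on (fun i => interferes y i j) (f j)) ->
  Var D (fun z => \sum_i f i z) <= \sum_i (degree y i)%:R * Var D (f i).
Proof.
move=> DB fI; pose c i z := f i z - Ex D (f i).
have cov0 i j : ~~ dependent y i j -> Ex D (fun z => c i z * c j z) = 0.
  move=> dij; rewrite (bernoulli_indep (S := fun l => interferes y l i)
    (T := fun l => interferes y l j)) //.
  - by rewrite Ex_centered mul0r.
  - move=> l Ili; apply: contra dij => Ilj; apply/existsP; exists l.
    by rewrite Ili.
  - by move=> z z' /fI e; rewrite /c e.
  - by move=> z z' /fI e; rewrite /c e.
have -> : Var D (fun z => \sum_i f i z) =
    \sum_i \sum_j Ex D (fun z => c i z * c j z).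
  rewrite /Var Ex_sum.
  rewrite (eq_Ex _ (g := fun z => \sum_i \sum_j c i z * c j z)).
    by rewrite Ex_sum; apply: eq_bigr => i _; rewrite Ex_sum.
  move=> z; rewrite -sumrB expr2 mulr_suml; apply: eq_bigr => i _.
  by rewrite mulr_sumr.
have covle i j : Ex D (fun z => c i z * c j z) <=
    2^-1 * ((dependent y i j)%:R * Var D (f i))
    + 2^-1 * ((dependent y i j)%:R * Var D (f j)).
  have [dij|dij] := boolP (dependent y i j); last first.
    by rewrite cov0 // !mul0r !mulr0 addr0.
  rewrite !mul1r -!ExZ -ExD; apply: le_Ex => z; rewrite -!/(c _ _).
  by have := sqr_ge0 (c i z - c j z); nra.
apply: (le_trans (ler_sum _ (fun i _ => ler_sum _ (fun j _ => covle i j)))).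
under eq_bigr do rewrite big_split.
rewrite big_split /= [X in _ + X]exchange_big /=.
(* By symmetry of [dependent], the two halves are the same double sum. *)
rewrite [X in _ + X](_ : _ = \sum_i \sum_j
    2^-1 * ((dependent y i j)%:R * Var D (f i))); last first.
  by apply: eq_bigr => i _; apply: eq_bigr => j _; rewrite dependentC.
rewrite -big_split /= ler_sum // => i _.
rewrite -mulr_sumr -mulr_suml -natr_degree.
by rewrite -mulrDl -[2^-1]div1r -splitr mul1r.
Qed.

End DependencyGraph.

(** Lagrange's identity: twice the defect of the squared inequality is a double sum of squares. *)
Lemma cauchy_schwarz_sum (R : rcfType) n (a b : 'I_n -> R) :
  \sum_i a i * b i <=
  Num.sqrt (\sum_i a i ^+ 2) * Num.sqrt (\sum_i b i ^+ 2).
Proof.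
have sum_sqr_ge0 (u : 'I_n -> R) : 0 <= \sum_i u i ^+ 2.
  by apply: sumr_ge0 => i _; rewrite sqr_ge0.
rewrite -sqrtrM //; apply: le_trans (ler_norm _) _.
rewrite -sqrtr_sqr ler_sqrt ?mulr_ge0 //.
have : 0 <= \sum_i \sum_j (a i * b j - a j * b i) ^+ 2.
  by apply: sumr_ge0 => i _.
have -> : \sum_i \sum_j (a i * b j - a j * b i) ^+ 2 =
  2 * ((\sum_i a i ^+ 2) * (\sum_i b i ^+ 2) - (\sum_i a i * b i) ^+ 2).
  transitivity (\sum_i \sum_j (a i ^+ 2 * b j ^+ 2 + b i ^+ 2 * a j ^+ 2
      + (- 2 * (a i * b i)) * (a j * b j))).
    by apply: eq_bigr => i _; apply: eq_bigr => j _; ring.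
  have prodE (u v : 'I_n -> R) :
      \sum_i \sum_j u i * v j = (\sum_i u i) * (\sum_j v j).
    by rewrite mulr_suml; apply: eq_bigr => i _; rewrite mulr_sumr.
  under eq_bigr do rewrite !big_split /=.
  by rewrite !big_split /= !prodE -mulr_sumr; ring.
by rewrite pmulr_rge0 // subr_ge0.
Qed.

(** * Horvitz-Thompson terms, their moments and the tail bound *)

Section HorvitzThompson.
Context {R : realType} {n : nat}.
Variables (y : outcomes R n) (D : design R n).
Local Notation p := (prop_treated D).

Definition HT_term (i : 'I_n) (z : assignment n) : R :=
  (z i)%:R * y i z / p i - (1 - (z i)%:R) * y i z / (1 - p i).

Lemma HT_termE i z :
  HT_term i z = if z i then y i z / p i else - (y i z / (1 - p i)).
Proof.
rewrite /HT_term; case: (z i); first by rewrite subrr !mul0r subr0 mul1r.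
by rewrite subr0 !mul0r sub0r mul1r.
Qed.

Lemma tau_HTE z : tau_HT y D z = n%:R^-1 * \sum_i HT_term i z.
Proof. by rewrite /tau_HT -mulrBr -sumrB. Qed.

Lemma var_BERE z :
  var_BER y D z = (n%:R ^+ 2)^-1 * \sum_i HT_term i z ^+ 2.
Proof.
rewrite /var_BER -mulrDr -big_split; congr (_ * _); apply: eq_bigr => i _ /=.
rewrite HT_termE; case: (z i).
  by rewrite subrr !mul0r addr0 mul1r expr_div_n.
by rewrite subr0 !mul0r add0r mul1r sqrrN expr_div_n.
Qed.

Lemma HT_term_depends_on j :
  depends_on (fun i => interferes y i j) (HT_term j).
Proof.
move=> z z' zz'; rewrite !HT_termE zz' ?/interferes ?eqxx //.
by rewrite (depends_on_interferes zz').
Qed.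

(** Writing each [sigma2] as its mean [m] plus a deviation, the degree-weighted sum becomes
    [n * d_avg * m] plus degrees times deviations, which Cauchy-Schwarz bounds. *)
Lemma Var_tau_HT_le : bernoulli_design D -> (0 < n)%N ->
  n%:R * (d_avg y)^-1 * Var D (tau_HT y D) <=
  n%:R^-1 * (\sum_i sigma2 y D i) + d_rms y * SD_sigma2 y D / d_avg y.
Proof.
move=> DB n0; have n0R : 0 < n%:R :> R by rewrite ltr0n.
have d0 := d_avg_gt0 y n0 : 0 < d_avg y :> R.
set m := n%:R^-1 * _.
rewrite (eq_Var _ tau_HTE) VarZ.
have := Var_sum_le DB HT_term_depends_on.
set V := Var D _; rewrite -/(sigma2 y D) => Vle.
have sumd : \sum_i (degree y i)%:R = n%:R * d_avg y :> R.
  by rewrite /d_avg mulrA divff ?mul1r // gt_eqF.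
have CS := cauchy_schwarz_sum (fun i => (degree y i)%:R)
  (fun i => sigma2 y D i - m).
(* Roots of sums become roots of averages, so that [d_rms] and [SD_sigma2] can be folded in [CS];
   the two factors [sqrt n] give [n]. *)
have sqrtn (u : R) : 0 <= u ->
    Num.sqrt u = Num.sqrt n%:R * Num.sqrt (n%:R^-1 * u).
  by move=> u0; rewrite -sqrtrM ?ler0n // mulrA divff ?mul1r // gt_eqF.
have sqr_sum_ge0 (u : 'I_n -> R) : 0 <= \sum_i u i ^+ 2.
  by apply: sumr_ge0 => i _; exact: sqr_ge0.
rewrite (sqrtn _ (sqr_sum_ge0 (fun i => (degree y i)%:R))) in CS.
rewrite (sqrtn _ (sqr_sum_ge0 (fun i => sigma2 y D i - m))) in CS.
rewrite -/(d_rms y) -/(SD_sigma2 y D) mulrACA -expr2 sqr_sqrtr ?ler0n // in CS.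
have {}Vle : V <= n%:R * (d_avg y * m + d_rms y * SD_sigma2 y D).
  apply: (le_trans Vle); rewrite mulrDr mulrA -sumd mulr_suml.
  rewrite -lerBlDl -sumrB; apply: le_trans CS.
  by rewrite ler_sum // => i _; rewrite mulrBr.
rewrite [leLHS](_ : _ = V * (n%:R * d_avg y)^-1); last first.
  by field; rewrite !gt_eqF.
rewrite ler_pdivrMr; last exact: mulr_gt0.
apply: (le_trans Vle).
by rewrite le_eqVlt; apply/orP; left; apply/eqP; field; rewrite gt_eqF.
Qed.

(** Only one arm survives for a given [z], and both inverse propensities are at most [k]. *)
Lemma HT_term_exp4_le (k : R) i z : 0 < k -> k^-1 <= p i <= 1 - k^-1 ->
  HT_term i z ^+ 4 <= k ^+ 4 * `|y i z| ^+ 4.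
Proof.
move=> k0 /andP[pk kp]; have ki0 : 0 < k^-1 by rewrite invr_gt0.
have inv_le (u : R) : k^-1 <= u -> `|u^-1| <= k.
  move=> ku; have u0 : 0 < u by exact: lt_le_trans ku.
  by rewrite gtr0_norm ?invr_gt0 // invf_ple // posrE.
rewrite -[HT_term i z ^+ 4]ger0_norm ?(exprn_even_ge0 _ (n := 4)) //.
rewrite normrX -exprMn; apply: lerXn2r.
- by rewrite nnegrE.
- by rewrite nnegrE mulr_ge0 // ltW.
rewrite HT_termE; case: ifP => _; rewrite ?normrN normrM mulrC ler_wpM2r //.
  exact: inv_le.
by apply: inv_le; lra.
Qed.

(** For [x >= 0], [x ^ 4] is at most 1 if [x <= 1], and at most [x ^ q] otherwise. *)
Lemma Ex_exp4_le (k q : R) i : 4 <= q ->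
  Ex D (fun z => `|y i z| `^ q) <= k `^ q ->
  Ex D (fun z => `|y i z| ^+ 4) <= 1 + k `^ q.
Proof.
move=> q4 Eq; rewrite -lerBlDl in Eq *; rewrite lerBlDl.
apply: (@le_trans _ _ (Ex D (fun z => 1 + `|y i z| `^ q))).
  apply: le_Ex => z; have [y1|y1] := leP `|y i z| 1.
    by apply: ler_wpDr; rewrite ?powR_ge0 // exprn_ile1.
  apply: ler_wpDl => //; rewrite -powR_mulrn //.
  by rewrite ler_powR // ltW.
by rewrite ExD Ex_cst lerD2l; lra.
Qed.

Lemma Var_mean_sqr_le (k q : R) : bernoulli_design D -> (0 < n)%N -> 0 < k ->
  4 <= q ->
  (forall i, k^-1 <= p i <= 1 - k^-1) ->
  (forall i, Ex D (fun z => `|y i z| `^ q) <= k `^ q) ->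
  Var D (fun z => n%:R^-1 * \sum_i HT_term i z ^+ 2) <=
  k ^+ 4 * (1 + k `^ q) * (d_avg y / n%:R).
Proof.
move=> DB n0 k0 q4 hp hq; have n0R : 0 < n%:R :> R by rewrite ltr0n.
rewrite VarZ.
(* A squared term depends on the same coordinates as the term itself. *)
have Vle := Var_sum_le DB (f := fun i z => HT_term i z ^+ 2)
  (fun j z z' zz' => congr1 (fun x => x ^+ 2) (HT_term_depends_on zz')).
rewrite (_ : _ * (d_avg y / _) = (n%:R^-1) ^+ 2 * \sum_i (degree y i)%:R *
    (k ^+ 4 * (1 + k `^ q))); last first.
  by rewrite -mulr_suml /d_avg; field; rewrite gt_eqF.
rewrite ler_wpM2l ?sqr_ge0 //; apply: (le_trans Vle).
apply: ler_sum => i _; rewrite ler_wpM2l //.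
apply: (le_trans (Var_le_Ex_sqr _ _)).
apply: le_trans (ler_wpM2l _ (Ex_exp4_le q4 (hq i))); last first.
  by rewrite exprn_ge0 // ltW.
rewrite -ExZ; apply: le_Ex => z.
by rewrite -exprM; exact: HT_term_exp4_le.
Qed.

Lemma Pr_var_AVG_le (k q eps : R) : bernoulli_design D -> (0 < n)%N -> 0 < k ->
  4 <= q ->
  (forall i, k^-1 <= p i <= 1 - k^-1) ->
  (forall i, Ex D (fun z => `|y i z| `^ q) <= k `^ q) ->
  0 < eps -> d_rms y * SD_sigma2 y D / d_avg y <= eps / 2 ->
  Pr D (fun z => n%:R * (d_avg y)^-1 *
    (var_AVG y D z - Var D (tau_HT y D)) <= - eps) <=
  k ^+ 4 * (1 + k `^ q) / (eps / 2) ^+ 2 * (d_avg y / n%:R).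
Proof.
move=> DB n0 k0 q4 hp hq eps0 SDle; have n0R : 0 < n%:R :> R by rewrite ltr0n.
have d0 := d_avg_gt0 y n0 : 0 < d_avg y :> R.
have e20 : 0 < eps / 2 by lra.
pose W z : R := n%:R^-1 * \sum_i HT_term i z ^+ 2.
(* Half of [eps] absorbs the heterogeneity error; the other half is left for Chebyshev. *)
apply: (@le_trans _ _ (Pr D (fun z => W z - Ex D W <= - (eps / 2)))).
  apply: le_Pr => z; rewrite mulrBr /var_AVG var_BERE.
  rewrite (_ : _ * (d_avg y * _) = W z); last first.
    by rewrite /W; field; rewrite !gt_eqF.
  have := Var_tau_HT_le DB n0.
  (* The slack here is the mean of the squared expectations of the terms, which makes the estimator
     conservative. *)
  have : n%:R^-1 * (\sum_i sigma2 y D i) <= Ex D W.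
    rewrite /W ExZ Ex_sum ler_wpM2l ?invr_ge0 ?ler0n //.
    by apply: ler_sum => i _; exact: Var_le_Ex_sqr.
  by lra.
apply: (le_trans (chebyshev_lower _ _ e20)).
by rewrite mulrAC ler_wpM2r ?invr_ge0 ?sqr_ge0 //; exact: Var_mean_sqr_le.
Qed.

End HorvitzThompson.

(** * Passage to the limit *)

Theorem proposition8 (R : realType)
    (y : forall n : nat, outcomes R n) (D : forall n : nat, design R n)
    (k q s : R)
    (hBernoulli : forall n : nat, bernoulli_design (D n))
    (hReg : regularity y D k q s) (hq : 4 <= q)
    (hdavg : (fun n : nat => d_avg (y n)) =o_\oo (fun n : nat => n%:R : R))
    (hSD : (fun n : nat => SD_sigma2 (y n) (D n)) =o_\oo
           (fun n : nat => (d_rms (y n))^-1 * d_avg (y n))) :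
  asymptotically_conservative y D (fun n : nat => var_AVG (y n) (D n)).
Proof.
(* Each little-o becomes an eventual bound with an arbitrary positive constant. *)
move/eqoP in hdavg; move/eqoP in hSD.
case: hReg => k0 _ _ reg.
have Pr_cvg0 (eps : R) : 0 < eps -> (fun n => Pr (D n) (fun z =>
    n%:R * (d_avg (y n))^-1 * (var_AVG (y n) (D n) z
      - Var (D n) (tau_HT (y n) (D n))) <= - eps)) @ \oo --> (0 : R).
  move=> eps0; pose C := k ^+ 4 * (1 + k `^ q) / (eps / 2) ^+ 2.
  have C0 : 0 < C.
    by rewrite /C divr_gt0 ?mulr_gt0 ?exprn_gt0 ?divr_gt0 ?ltr_pwDl ?powR_ge0.
  apply/cvgrPdist_le => e e0; near=> n.
  have n0 : (0 < n)%N by near: n; exists 1%N.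
  have n0R : 0 < n%:R :> R by rewrite ltr0n.
  have d0 := d_avg_gt0 (y n) n0 : 0 < d_avg (y n) :> R.
  have r0 := d_rms_gt0 (y n) n0 : 0 < d_rms (y n) :> R.
  rewrite sub0r normrN ger0_norm ?Pr_ge0 //.
  apply: le_trans
    (@Pr_var_AVG_le _ _ _ _ k q eps _ n0 k0 hq _ _ eps0 _) _ => //.
  - by move=> i; case: (reg n i).
  - by move=> i; case: (reg n i).
  - have : `|SD_sigma2 (y n) (D n)| <=
        eps / 2 * `|(d_rms (y n))^-1 * d_avg (y n)|.
      by near: n; apply: hSD; rewrite divr_gt0.
    rewrite (gtr0_norm (mulr_gt0 _ _)) ?invr_gt0 // ger0_norm ?sqrtr_ge0 //.
    rewrite ler_pdivrMr // mulrCA mulrC ler_pdivlMr //.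
    by rewrite mulrC.
  (* The tail bound is [C * (d_avg / n)], whence the constant [e / C] for [hdavg]. *)
  rewrite -/C mulrC -ler_pdivlMr // ler_pdivrMr //.
  have : `|d_avg (y n)| <= e / C * `|n%:R|.
    by near: n; apply: hdavg; rewrite divr_gt0.
  by rewrite !gtr0_norm.
split => [eps eps0|]; first by apply/cvg_ex; exists 0; exact: Pr_cvg0.
(* The inner limit is 0 for every positive [eps], so the outer limit is that of a function constant
   to the right of 0. *)
apply: cvg_near_cst; near=> eps.
have eps0 : 0 < eps by near: eps; exact: nbhs_right_gt.
exact/cvg_lim/Pr_cvg0.
Unshelve. all: by end_near.
Qed.
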